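(* Let $G$ be an infinite finitely generated group and $S$ a finite generating set of $G$. Then the domino problem positive-reduces to the seeded domino problem: $\mathrm{DP}(G,S)\leq_p \mathrm{SDP}(G,S)$.
   Context: For a finite alphabet $A$, a nearest neighbor pattern is a tuple $(a,b,s)$ with $a,b\in A$, $s\in S$; it appears in $x\in A^G$ if there is $g\in G$ with $x(g)=a$ and $x(gs)=b$. For a finite set $\mathcal F$ of nearest neighbor patterns, $X_{\mathcal F}\subseteq A^G$ is the set of configurations $x:G\to A$ in which no pattern of $\mathcal F$ appears. Domino problem $\mathrm{DP}(G,S)$: given a finite alphabet $A$ and a finite set $\mathcal F$ of nearest neighbor forbidden patterns, determine whether $X_{\mathcal F}$ is non-empty (yes instances are those with $X_{\mathcal F}\neq\emptyset$). Seeded domino problem $\mathrm{SDP}(G,S)$: given a finite alphabet $A$, a finite set $\mathcal F$ of nearest neighbor forbidden patterns and a letter $a_0\in A$, determine whether there is $x\in X_{\mathcal F}$ with $x(1_G)=a_0$. Decision problems are identified with the languages of (encodings of) their yes instances. For languages $L,L'$, $L\leq_p L'$ ($L$ positive-reduces to $L'$) means that for any input $w$ one can compute finitely many finite sets $F_1(w),\dots,F_n(w)$ such that $w\in L$ if and only if there is $i\in\{1,\dots,n\}$ with $F_i(w)\subseteq L'$. *)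

(* Defs.v *)
From HB Require Import structures.
From mathcomp Require Import all_boot finmap.
From mathcomp Require Import boolp classical_sets cardinality.

Set Implicit Arguments.
Unset Strict Implicit.
Unset Printing Implicit Defensive.

Local Open Scope classical_set_scope.
Local Open Scope group_scope.

(* Total recursive functions in the sense of Kleene: the least class containing
   the basic functions and closed under composition, primitive recursion and
   minimization of regular functions.  In [recursive_mu] the hypothesis on [h]
   says both that [f] is regular and that [h t] is the least zero of [f]. *)
Inductive recursive : forall n, (n.-tuple nat -> nat) -> Prop :=
| recursive_zero : recursive (fun _ : 0.-tuple nat => 0%N)
| recursive_succ : recursive (fun t : 1.-tuple nat => (thead t).+1)
| recursive_proj n (i : 'I_n) : recursive (fun t : n.-tuple nat => tnth t i)
| recursive_comp m n (f : m.-tuple nat -> nat)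
    (g : 'I_m -> n.-tuple nat -> nat) :
    recursive f -> (forall i, recursive (g i)) ->
    recursive (fun t : n.-tuple nat => f [tuple g i t | i < m])
| recursive_prim n (f : n.-tuple nat -> nat) (g : n.+2.-tuple nat -> nat) :
    recursive f -> recursive g ->
    recursive (fun t : n.+1.-tuple nat =>
      iteri (thead t) (fun k r => g [tuple of k :: r :: behead t])
        (f [tuple of behead t]))
| recursive_mu n (f : n.+1.-tuple nat -> nat) (h : n.-tuple nat -> nat) :
    recursive f ->
    (forall t, f [tuple of h t :: t] = 0%N /\
       forall k, (k < h t)%N -> f [tuple of k :: t] <> 0%N) ->
    recursive h.

(* Words are represented by natural numbers and finite sequences of words by
   the bijection [CodeSeq.code : seq nat -> nat]. *)
Definition language := set nat.

Definition computable_families (f : nat -> seq (seq nat)) :=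
  recursive (fun t : 1.-tuple nat =>
    CodeSeq.code [seq CodeSeq.code F | F <- f (thead t)]).

(* [f w] lists the finite sets F_1(w), ..., F_n(w), each given by a list of its
   elements; n depends on w and may be 0. *)
Definition positive_reduces (L L' : language) :=
  exists f : nat -> seq (seq nat), computable_families f /\
    forall w, L w <-> exists2 F, F \in f w & [set` F] `<=` L'.

Definition generates (G : groupType) (S : {fset G}) :=
  forall H : {pred G}, group_closed H -> {subset S <= H} -> H =i predT.

Section Domino.

Variables (G : groupType) (S : {fset G}).

Definition pattern (A : finType) : finType := (A * A * S)%type.

Definition appears (A : finType) (p : pattern A) (x : G -> A) :=
  let: (a, b, s) := p in exists g : G, x g = a /\ x (g * val s) = b.

Definition subshift (A : finType) (F : {set pattern A}) : set (G -> A) :=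
  [set x | forall p, p \in F -> ~ appears p x].

(* Instances are presented with the alphabet {0, ..., n-1}, with the finite set
   of forbidden patterns given by a list, and with generators replaced by their
   rank in a fixed enumeration of S. *)
Definition pattern_code n (p : pattern 'I_n) : nat :=
  let: (a, b, s) := p in CodeSeq.code [:: a : nat; b : nat; enum_rank s : nat].

Definition DP_code n (F : seq (pattern 'I_n)) : nat :=
  CodeSeq.code (n :: [seq pattern_code p | p <- F]).

Definition SDP_code n (F : seq (pattern 'I_n)) (a0 : 'I_n) : nat :=
  CodeSeq.code [:: DP_code F; a0 : nat].

Definition DP : language :=
  [set w | exists n (F : seq (pattern 'I_n)),
     w = DP_code F /\ subshift [set:: F] !=set0].

Definition SDP : language :=
  [set w | exists n (F : seq (pattern 'I_n)) (a0 : 'I_n),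
     w = SDP_code F a0 /\ exists2 x, subshift [set:: F] x & x 1 = a0].

End Domino.

(* Main.v *)
(* X_F is non-empty iff some letter occurs at the identity of some element of
   X_F, so a DP instance w with n letters is positive iff one of the SDP
   instances (w, a) with a < n is.  It is enough to compute any upper bound for
   n, since letters outside the alphabet never give a valid SDP instance; as w
   codes a sequence with head n, w itself is such a bound. *)
Require Import Defs.
From mathcomp Require Import all_boot finmap.
From mathcomp Require Import boolp classical_sets cardinality.

Set Implicit Arguments.
Unset Strict Implicit.
Unset Printing Implicit Defensive.

Local Open Scope classical_set_scope.

Lemma eq_recursive n (f g : n.-tuple nat -> nat) :
  f =1 g -> recursive f -> recursive g.
Proof. by move=> /funext->. Qed.

Lemma recursive_S n (g : n.-tuple nat -> nat) :
  recursive g -> recursive (fun t => (g t).+1).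
Proof.
move=> rg; apply: eq_recursive (recursive_comp recursive_succ (fun=> rg)) => t.
by rewrite /thead tnth_mktuple.
Qed.

Lemma recursive_cst n (c : nat) : recursive (fun _ : n.-tuple nat => c).
Proof.
elim: c => [|c IHc].
  have r0 (i : 'I_0) : recursive (fun _ : n.-tuple nat => 0) by case: i.
  exact: eq_recursive (recursive_comp recursive_zero r0).
exact: recursive_S.
Qed.

(** With [nth] and a numeral index, projections of an explicit tuple [k :: r :: t] reduce by
    computation. *)
Lemma recursive_nth n (i : nat) : i < n ->
  recursive (fun t : n.-tuple nat => nth 0 t i).
Proof.
move=> ltin; apply: eq_recursive (recursive_proj (Ordinal ltin)) => t.
by rewrite (tnth_nth 0).
Qed.

(** Lets the step of an iteration call a function of the parameters alone, skipping the counter and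
    the accumulator. *)
Lemma recursive_behead2 n (g : n.-tuple nat -> nat) : recursive g ->
  recursive (fun t : n.+2.-tuple nat => g [tuple of behead (behead t)]).
Proof.
move=> rg.
have rn (i : 'I_n) := @recursive_nth n.+2 i.+2 (ltn_ord i).
apply: eq_recursive (recursive_comp rg rn) => t.
congr g; apply: eq_from_tnth => i.
by rewrite tnth_mktuple (tnth_nth 0) /= !nth_behead.
Qed.

(** Primitive recursion on [n.+1] arguments, composed with [c t :: t]: the number of rounds may
    itself be computed from the parameters. *)
Lemma recursive_iteri n (c b : n.-tuple nat -> nat)
    (s : n.+2.-tuple nat -> nat) :
  recursive c -> recursive b -> recursive s ->
  recursive (fun t =>
    iteri (c t) (fun k r => s [tuple of k :: r :: t]) (b t)).
Proof.
move=> rc rb rs.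
pose g (i : 'I_n.+1) (t : n.-tuple nat) := nth 0 (c t :: t) i.
have rg i : recursive (g i).
  case: i => [[|i] lti] //; exact: recursive_nth.
apply: eq_recursive (recursive_comp (recursive_prim rb rs) rg) => t.
have -> : [tuple g i t | i < n.+1] = [tuple of c t :: t].
  by apply: eq_from_tnth => i; rewrite tnth_mktuple (tnth_nth 0).
rewrite theadE.
have -> : [tuple of behead [tuple of c t :: t]] = t by exact: val_inj.
apply: eq_iteri => k r; congr s; exact: val_inj.
Qed.

Lemma recursive_add n (g h : n.-tuple nat -> nat) :
  recursive g -> recursive h -> recursive (fun t => g t + h t).
Proof.
move=> rg rh.
have rS := recursive_S (@recursive_nth n.+2 1 isT).
apply: eq_recursive (recursive_iteri rg rh rS) => t /=.
by elim: (g t) => //= k ->; rewrite addSn.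
Qed.

Lemma recursive_mul n (g h : n.-tuple nat -> nat) :
  recursive g -> recursive h -> recursive (fun t => g t * h t).
Proof.
move=> rg rh.
apply: eq_recursive (recursive_iteri rg (recursive_cst n 0)
  (recursive_add (recursive_behead2 rh) (@recursive_nth n.+2 1 isT))) => t /=.
have E k r : [tuple of behead (behead [tuple of k :: r :: t])] = t.
  exact: val_inj.
by elim: (g t) => //= k ->; rewrite E mulSn.
Qed.

Lemma recursive_exp2 n (g : n.-tuple nat -> nat) :
  recursive g -> recursive (fun t => 2 ^ g t).
Proof.
move=> rg; have r1 := @recursive_nth n.+2 1 isT.
have r2 := recursive_add r1 r1.
apply: eq_recursive (recursive_iteri rg (recursive_cst n 1) r2) => t /=.
by elim: (g t) => //= k ->; rewrite expnS mul2n addnn.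
Qed.

(** By definition [CodeSeq.code (n :: s)] is [2 ^ n * (CodeSeq.code s).*2.+1]. *)
Lemma recursive_code_cons n (g : n.-tuple nat -> nat)
    (s : n.-tuple nat -> seq nat) :
  recursive g -> recursive (fun t => CodeSeq.code (s t)) ->
  recursive (fun t => CodeSeq.code (g t :: s t)).
Proof.
move=> rg rs.
have rS := recursive_S (recursive_add rs rs).
by apply: eq_recursive (recursive_mul (recursive_exp2 rg) rS) => t; rewrite addnn.
Qed.

Lemma head_lt_code n s : n < CodeSeq.code (n :: s).
Proof. by have /andP[] := CodeSeq.ltn_code (n :: s). Qed.

(** Written with [iteri] to fit [recursive_iteri]; the bound [m] is kept apart from [w] to allow
    induction on it. *)
Definition seedings (m w : nat) : seq (seq nat) :=
  iteri m (fun a r => [:: CodeSeq.code [:: w; a]] :: r) [::].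

Lemma mem_seedings m w F :
  reflect (exists2 a, a < m & F = [:: CodeSeq.code [:: w; a]])
    (F \in seedings m w).
Proof.
elim: m => [|m IHm]; first by right; case.
rewrite -[seedings m.+1 w]/(_ :: seedings m w) inE.
apply: (iffP orP) => [[/eqP->|/IHm[a lt_am ->]]|].
- by exists m.
- by exists a; rewrite // ltnW.
case=> a; rewrite ltnS leq_eqVlt => /predU1P[->|lt_am] eF; first by left; apply/eqP.
by right; apply/IHm; exists a.
Qed.

Lemma computable_seedings : computable_families (fun w => seedings w w).
Proof.
have r0 := @recursive_nth 3 0 isT; have r1 := @recursive_nth 3 1 isT.
have r2 := @recursive_nth 3 2 isT; have nil := recursive_cst 3 0.
have rw := @recursive_nth 1 0 isT.
have single := recursive_code_cons (s := fun=> [::]).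
have pair := recursive_code_cons (s := fun t => [:: nth 0 t 0]) r2
  (single _ _ r0 nil).
(* The arguments are the letter, the accumulator and [w]. The accumulator is already the code of the
   list built so far, so the formula for the code of a cons is applied to it directly, starting from
   0, the code of the empty list. *)
have step := recursive_mul (recursive_exp2 (single _ _ pair nil))
  (recursive_S (recursive_add r1 r1)).
apply: eq_recursive (recursive_iteri rw (recursive_cst 1 0) step) => t.
rewrite /thead (tnth_nth 0) /= /seedings; set w := nth 0 t 0.
(* Only the two iteration counts are generalized; [w] stays fixed inside the instances. *)
by elim: {1 3}w => //= m ->; rewrite addnn.
Qed.

Theorem lemma6 (G : groupType) (S : {fset G})
    (G_infinite : infinite_set [set: G]) (S_generates : generates S) :
  positive_reduces (DP S) (SDP S).
Proof.
exists (fun w => seedings w w); split; first exact: computable_seedings.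
move=> w; split=> [[n [F [-> [x Xx]]]]|[_ /mem_seedings[a _ ->] sub]].
  exists [:: SDP_code F (x 1%g)].
    apply/mem_seedings; exists (x 1%g) => //.
    exact: ltn_trans (head_lt_code _ _).
  move=> v /=; rewrite inE => /eqP->; exists n, F, (x 1%g); split=> //.
  by exists x.
(* Injectivity of the coding forces [w] to be the code of a genuine instance [F], whatever the size
   of [a]. *)
have [|n [F [a0 [/(can_inj CodeSeq.codeK)[-> _] [x Xx _]]]]] :=
  sub (CodeSeq.code [:: w; a]); first by rewrite /= mem_head.
by exists n, F; split=> //; exists x.
Qed.
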